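(* There is an absolute constant $C>0$, not exceeding the positive root of the equation $\zeta^{3}-3\zeta-1=0$, such that the following holds. Let $\mathbb{S}^{2}=\{\mathbf{x}\in\mathbb{R}^{3}:\|\mathbf{x}\|=1\}$, let $\mathbf{x}(\cdot)\in \mathrm{C}^{2}(\mathbb{R}\to\mathbb{S}^{2})$, and let $$\mathbf{e}\in\mathrm{argmin}\left\{\|\mathbf{x}-\mathbf{x}(\cdot)\|_{\infty}:\ \mathbf{x}\in\mathbb{S}^{2}\right\},$$ that is, $\mathbf{e}\in\mathbb{S}^2$ is a point at which the function $\mathbf{x}\mapsto\sup_{t\in\mathbb{R}}\|\mathbf{x}-\mathbf{x}(t)\|$ on $\mathbb{S}^{2}$ attains its minimum. Suppose that $$\lambda:=\inf_{t\in\mathbb{R}}\langle\mathbf{x}(t),\mathbf{e}\rangle>0.$$ Then $$\|\dot{\mathbf{x}}(\cdot)\|_{\infty}^{2}\le\frac{C^{2}}{\lambda}\left\|\sqrt{1-\langle\mathbf{e},\mathbf{x}(\cdot)\rangle^{2}}\right\|_{\infty}\|\nabla_{\dot{\mathbf{x}}}\dot{\mathbf{x}}(\cdot)\|_{\infty}\le\frac{C^{2}\sqrt{1-\lambda^{2}}}{\lambda}\,\|\nabla_{\dot{\mathbf{x}}}\dot{\mathbf{x}}(\cdot)\|_{\infty}$$ whenever $\|\nabla_{\dot{\mathbf{x}}}\dot{\mathbf{x}}(\cdot)\|_{\infty}<\infty$.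
   Context: $\langle\cdot,\cdot\rangle$ and $\|\cdot\|$ are the standard Euclidean inner product and norm on $\mathbb{R}^{3}$, and $\mathbb{S}^2$ carries the induced Riemannian metric with Levi-Civita connection $\nabla$. $\dot{\mathbf{x}}(t)\in T_{\mathbf{x}(t)}\mathbb{S}^2$ is the tangent vector of the curve, and $\nabla_{\dot{\mathbf{x}}}\dot{\mathbf{x}}(t)$ is the covariant derivative of $\dot{\mathbf{x}}(\cdot)$ along $\mathbf{x}(\cdot)$ in $\mathbb{S}^2$. For a scalar- or vector-valued function of $t\in\mathbb{R}$, $\|\cdot\|_{\infty}$ denotes the supremum over $t\in\mathbb{R}$ of its absolute value or norm. *)

(* Defs.v *)
From HB Require Import structures.
From mathcomp Require Import all_boot all_order all_algebra.
From mathcomp Require Import all_classical all_reals all_analysis.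
Set Implicit Arguments.
Unset Strict Implicit.
Unset Printing Implicit Defensive.
Import Order.TTheory GRing.Theory Num.Theory numFieldNormedType.Exports.
Local Open Scope classical_set_scope.
Local Open Scope ring_scope.

Definition dotp (R : realType) (u v : 'rV[R]_3) : R :=
  \sum_(i < 3) u ord0 i * v ord0 i.

(* The library norm `|u| on row vectors is the max norm; it is used here only
   for the topology underlying derivatives. *)
Definition enorm (R : realType) (u : 'rV[R]_3) : R := Num.sqrt (dotp u u).

Definition sphere2 (R : realType) : set 'rV[R]_3 := [set u | enorm u = 1].

(* The suprema take values in \bar R, so that they are +oo (and not a junk
   real value) for unbounded functions. *)
Definition supnorm (R : realType) (f : R -> R) : \bar R :=
  ereal_sup (range (fun t => (`|f t|)%:E)).

Definition vsupnorm (R : realType) (f : R -> 'rV[R]_3) : \bar R :=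
  ereal_sup (range (fun t => (enorm (f t))%:E)).

(* C^2 maps R -> S^2, S^2 being an embedded submanifold of R^3. *)
Definition C2_sphere_curve (R : realType) (x : R -> 'rV[R]_3) : Prop :=
  [/\ forall t, sphere2 (x t),
      forall t, derivable x t 1,
      forall t, derivable x^`()%classic t 1 &
      continuous x^`(2)%classic].

(* Orthogonal projection of R^3 onto T_p S^2 = {v | <v, p> = 0}, for p in S^2. *)
Definition tanproj (R : realType) (p v : 'rV[R]_3) : 'rV[R]_3 :=
  v - dotp v p *: p.

(* Covariant derivative along the curve x of a vector field V tangent to S^2
   along x: for the metric induced by R^3, the Levi-Civita covariant derivative
   is the tangential component of the derivative in R^3. The lemmas after
   [dotp_sphere2] record the defining properties: tangency, Leibniz rule,
   compatibility with the metric, vanishing torsion. *)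
Definition covderiv (R : realType) (x V : R -> 'rV[R]_3) (t : R) : 'rV[R]_3 :=
  tanproj (x t) (V^`()%classic t).

Definition supdist (R : realType) (x : R -> 'rV[R]_3) (p : 'rV[R]_3) : \bar R :=
  vsupnorm (fun t => p - x t).

Definition sphere_argmin (R : realType) (F : 'rV[R]_3 -> \bar R)
    : set 'rV[R]_3 :=
  [set e | sphere2 e /\ forall p, sphere2 p -> (F e <= F p)%E].

Lemma dotpDl (R : realType) (u v w : 'rV[R]_3) :
  dotp (u + v) w = dotp u w + dotp v w.
Proof. by rewrite -big_split; apply: eq_bigr => i _; rewrite mxE mulrDl. Qed.

Lemma dotpZl (R : realType) (a : R) (u w : 'rV[R]_3) :
  dotp (a *: u) w = a * dotp u w.
Proof. by rewrite mulr_sumr; apply: eq_bigr => i _; rewrite mxE mulrA. Qed.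

Lemma dotpC (R : realType) (u v : 'rV[R]_3) : dotp u v = dotp v u.
Proof. by apply: eq_bigr => i _; rewrite mulrC. Qed.

Lemma dotp_sphere2 (R : realType) (p : 'rV[R]_3) : sphere2 p -> dotp p p = 1.
Proof.
rewrite /sphere2 /= /enorm => h.
have p0 : 0 <= dotp p p by apply: sumr_ge0 => i _; rewrite -expr2 sqr_ge0.
by rewrite -(sqr_sqrtr p0) h expr1n.
Qed.

Lemma tanproj_tangent (R : realType) (p v : 'rV[R]_3) :
  sphere2 p -> dotp (tanproj p v) p = 0.
Proof.
by move=> /dotp_sphere2 pp; rewrite dotpDl -scaleNr dotpZl pp mulr1 subrr.
Qed.

Lemma covderiv_tangent (R : realType) (x V : R -> 'rV[R]_3) (t : R) :
  sphere2 (x t) -> dotp (covderiv x V t) (x t) = 0.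
Proof. exact: tanproj_tangent. Qed.

Lemma dotp_tanprojl (R : realType) (p v w : 'rV[R]_3) :
  dotp w p = 0 -> dotp (tanproj p v) w = dotp v w.
Proof.
by move=> wp; rewrite dotpDl -scaleNr dotpZl (dotpC p) wp mulr0 addr0.
Qed.

Lemma covderivZ (R : realType) (x V : R -> 'rV[R]_3) (f : R -> R) (t : R) :
  dotp (V t) (x t) = 0 -> derivable f t 1 -> derivable V t 1 ->
  covderiv x (fun s => f s *: V s) t =
  f^`()%classic t *: V t + f t *: covderiv x V t.
Proof.
move=> Vx df dV.
have dVi i j := (derivable_mxP _ _ _).1 dV i j.
have dfV : derivable (fun s => f s *: V s) t 1.
  apply/derivable_mxP => i j.
  have -> : (fun s => (f s *: V s) i j) = f * (fun s => V s i j).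
    by apply/funext => s; rewrite mxE.
  exact: derivableM.
have E : (fun s => f s *: V s)^`()%classic t =
         f^`()%classic t *: V t + f t *: V^`()%classic t.
  rewrite !derive1E derive_mx // [in RHS](derive_mx dV).
  apply/matrixP => i j; rewrite !mxE.
  have -> : (fun s => (f s *: V s) i j) = f * (fun s => V s i j).
    by apply/funext => s; rewrite mxE.
  by rewrite deriveM // addrC; congr (_ + _); exact: mulrC.
rewrite /covderiv E /tanproj dotpDl !dotpZl Vx mulr0 add0r scalerBr.
by rewrite scalerA addrA.
Qed.

Lemma covderiv_metric (R : realType) (x V W : R -> 'rV[R]_3) (t : R) :
  dotp (V t) (x t) = 0 -> dotp (W t) (x t) = 0 ->
  derivable V t 1 -> derivable W t 1 ->
  (fun s => dotp (V s) (W s))^`()%classic t =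
  dotp (covderiv x V t) (W t) + dotp (V t) (covderiv x W t).
Proof.
move=> Vx Wx dV dW.
rewrite (dotpC (V t)) !dotp_tanprojl // (dotpC _ (V t)).
have dVi i := (derivable_mxP _ _ _).1 dV ord0 i.
have dWi i := (derivable_mxP _ _ _).1 dW ord0 i.
rewrite !derive1E (derive_mx dV) (derive_mx dW).
have -> : (fun s => dotp (V s) (W s)) =
    \sum_(i < 3) ((fun s => V s ord0 i) * (fun s => W s ord0 i)).
  by apply/funext => s; rewrite fct_sumE.
rewrite derive_sum => [|i]; last exact: derivableM.
rewrite -big_split; apply: eq_bigr => i _; rewrite !mxE deriveM // addrC.
by congr (_ + _); exact: mulrC.
Qed.

(* For a C^2 map x of two parameters, the hypothesis is Schwarz's theorem. *)
Lemma covderiv_torsion_free (R : realType) (x : R -> R -> 'rV[R]_3) (s t : R) :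
  (fun s' => (x s')^`()%classic t)^`()%classic s = (fun t' => (x^~ t')^`()%classic s)^`()%classic t ->
  covderiv (x^~ t) (fun s' => (x s')^`()%classic t) s =
  covderiv (x s) (fun t' => (x^~ t')^`()%classic s) t.
Proof. by rewrite /covderiv => ->. Qed.

(* Main.v *)
Require Import Defs.
From mathcomp Require Import all_boot all_order all_algebra.
From mathcomp Require Import all_classical all_reals all_analysis.
From mathcomp Require Import ring lra.
Set Implicit Arguments.
Unset Strict Implicit.
Unset Printing Implicit Defensive.
Import Order.TTheory GRing.Theory Num.Theory numFieldNormedType.Exports.
Local Open Scope classical_set_scope.
Local Open Scope ring_scope.

(** Write h(t) for the height of x(t) over the equator orthogonal to e, v(t)
    for the speed, A for the supremum of the norm of the covariant
    acceleration and S for sqrt (1 - lambda^2).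

    Since x is a unit vector, the radial part of its acceleration in space is
    - v^2 x.  Pairing with e gives h'' = <acc, e> - v^2 h, where only the
    component of e tangent at x(t), of norm sqrt (1 - h^2) <= S, contributes to
    the first term.  Hence h'' <= A S - lambda v^2 ([height_derive2_le]): a
    fast curve has a very concave height, which is incompatible with
    lambda <= h <= 1 unless v drops quickly.  But v is A-Lipschitz
    ([speed_lipschitz]).

    Start at a time a and move, for the time v(a) / A during which v is bounded
    below by v(a) - A r, in the direction in which h initially does not
    increase.  Comparison with the quartic polynomial whose second derivative
    is A S - lambda (v(a) - A r)^2 yields ([quartic_bound])
      lambda v(a)^4 <= 2 A S v(a)^2 + 4 A^2 (1 - lambda).
    With Y = lambda v(a)^2, B = A S and 2 lambda (1 - lambda) <= S^2 this reads
    Y^2 <= 2 B Y + 2 B^2, so Y <= (1 + sqrt 3) B.  The constant C = 5/3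
    satisfies C^2 = 25/9 > 1 + sqrt 3, and the cubic is negative at 5/3 and
    positive at 2, so its positive root is larger.

    The second inequality is an equality of coefficients: the supremum of
    sqrt (1 - h^2) is S ([supnorm_sine]). *)

(** * Euclidean geometry of row vectors *)

Lemma dotp_ge0 (R : realType) (u : 'rV[R]_3) : 0 <= dotp u u.
Proof. by apply: sumr_ge0 => i _; rewrite -expr2 sqr_ge0. Qed.

Lemma sqr_enorm (R : realType) (u : 'rV[R]_3) : enorm u ^+ 2 = dotp u u.
Proof. by rewrite sqr_sqrtr// dotp_ge0. Qed.

Lemma enorm_ge0 (R : realType) (u : 'rV[R]_3) : 0 <= enorm u.
Proof. exact: sqrtr_ge0. Qed.

Lemma ler_norm_dotp (R : realType) (u v : 'rV[R]_3) :
  `|dotp u v| <= enorm u * enorm v.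
Proof.
rewrite -(@ler_pXn2r _ 2) ?nnegrE ?mulr_ge0 ?enorm_ge0//.
rewrite real_normK ?num_real// exprMn !sqr_enorm /dotp !big_ord_recl !big_ord0.
(* Lagrange's identity: the difference is a sum of three squares. *)
move: (u _ _) (u _ _) (u _ _) (v _ _) (v _ _) (v _ _) => a b c x y z.
have := sqr_ge0 (a * y - b * x); have := sqr_ge0 (a * z - c * x).
have := sqr_ge0 (b * z - c * y); lra.
Qed.

Lemma is_derive_dotp (R : realType) (V W : R -> 'rV[R]_3) (t : R)
    (dV dW : 'rV[R]_3) :
  is_derive t 1 V dV -> is_derive t 1 W dW ->
  is_derive t 1 (fun s => dotp (V s) (W s)) (dotp dV (W t) + dotp (V t) dW).
Proof.
move=> [DV <-] [DW <-].
have dVi i := (derivable_mxP _ _ _).1 DV ord0 i.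
have dWi i := (derivable_mxP _ _ _).1 DW ord0 i.
rewrite (derive_mx DV) (derive_mx DW).
have -> : (fun s => dotp (V s) (W s)) =
    \sum_(i < 3) ((fun s => V s ord0 i) * (fun s => W s ord0 i)).
  by apply/funext => s; rewrite fct_sumE.
rewrite -big_split /=.
apply: is_derive_sum => i; rewrite !mxE addrC [X in _ + X]mulrC.
by apply: is_deriveM; apply/derivableP.
Qed.

(** * Mean value estimates *)

Lemma derive_bound_le (R : realType) (f df : R -> R) (A a b : R) :
  (forall t : R, is_derive t 1 f (df t)) -> (forall t : R, `|df t| <= A) ->
  `|f b - f a| <= A * `|b - a|.
Proof.
move=> Df dfA; wlog ab : a b / a <= b => [H|].
  by case/orP: (le_total a b) => /H // ba; rewrite distrC (distrC b).
have cf : {within `[a, b], continuous f}.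
  by apply: derivable_within_continuous => t _; case: (Df t).
have [c _ ->] := MVT_segment ab (fun t _ => Df t) cf.
by rewrite normrM ler_wpM2r.
Qed.

Lemma le_tangent_of_derive2_le0 (R : realType) (f df ddf : R -> R) (s : R) :
  (forall t : R, is_derive t 1 f (df t)) -> (forall t : R, is_derive t 1 df (ddf t)) ->
  0 <= s -> (forall t, 0 <= t <= s -> ddf t <= 0) -> f s <= f 0 + df 0 * s.
Proof.
move=> Df Ddf s0 H.
have mv (g dg : R -> R) r : (forall t : R, is_derive t 1 g (dg t)) -> 0 <= r ->
    exists2 c, 0 <= c <= r & g r - g 0 = dg c * r.
  move=> Dg r0.
  have cg : {within `[0, r], continuous g}.
    by apply: derivable_within_continuous => t _; case: (Dg t).
  have [c] := MVT_segment r0 (fun t _ => Dg t) cg.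
  by rewrite in_itv/= subr0; exists c.
have [c /andP[c0 cs] E] := mv _ _ _ Df s0.
have [d /andP[d0 dc] E'] := mv _ _ _ Ddf c0.
have dd : ddf d <= 0 by apply: H; rewrite d0 (le_trans dc).
have : df c * s <= df 0 * s.
  by rewrite ler_wpM2r// -subr_le0 E' mulr_le0_ge0.
by rewrite -E lerBlDl.
Qed.

(** The comparison at the heart of the proof, for a height h and a speed v.
    The time v a / A is the largest for which the linear lower bound on v stays
    nonnegative, so that it can be squared. *)
Lemma quartic_bound (R : realType) (h dh ddh v : R -> R) (A B l a : R) :
  (forall t : R, is_derive t 1 h (dh t)) -> (forall t : R, is_derive t 1 dh (ddh t)) ->
  0 < A -> 0 <= l -> (forall t, l <= h t <= 1) -> 0 <= v a ->
  (forall t, v a - A * `|t - a| <= v t) ->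
  (forall t, ddh t <= B - l * v t ^+ 2) ->
  l * (v a ^+ 2) ^+ 2 <= 2 * B * v a ^+ 2 + 4 * A ^+ 2 * (1 - l).
Proof.
move=> Dh Ddh A0 l0 hl; set V := v a => V0 vL hB.
(* The sign sg is the direction of travel along which h does not increase. *)
have [sg [sg2 sgh]] : exists sg : R, `|sg| = 1 /\ sg * dh a <= 0.
  have [h0|h0] := leP (dh a) 0.
    by exists 1; rewrite normr1 mul1r.
  by exists (-1); rewrite normrN1 mulN1r oppr_le0 ltW.
(* p'' t = B - l (V - A t)^2 and p 0 = p' 0 = 0. *)
pose p : {poly R} := (B / 2 - l * V ^+ 2 / 2) *: 'X^2
  + (l * V * A / 3) *: 'X^3 - (l * A ^+ 2 / 12) *: 'X^4.
have dpE t : p^`()^`().[t] = B - l * (V - A * t) ^+ 2.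
  by rewrite /p !poly.derivE !hornerE /=; field.
have shift (t : R) : is_derive t 1 (fun r => a + sg * r) sg.
  have -> : (fun r => a + sg * r) = horner (a%:P + sg *: 'X).
    by apply/funext => r; rewrite !hornerE.
  by apply: is_derive_eq; rewrite !poly.derivE !hornerE.
have [s VE] : exists s, V = A * s.
  by exists (V / A); rewrite mulrCA divff ?gt_eqF// mulr1.
have s0 : 0 <= s by rewrite -(pmulr_rge0 _ A0) -VE.
pose f := (fun r => h (a + sg * r)) - horner p.
pose df r := sg * dh (a + sg * r) - p^`().[r].
pose ddf r := sg * (sg * ddh (a + sg * r)) - p^`()^`().[r].
have Df (t : R) : is_derive t 1 f (df t).
  apply: is_deriveB; rewrite mulrC.
  exact: (is_derive1_comp (Dh _) (shift t)).
have Ddf (t : R) : is_derive t 1 df (ddf t).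
  apply: is_deriveB; apply: is_deriveZ; rewrite mulrC.
  exact: (is_derive1_comp (Ddh _) (shift t)).
have ddf0 t : 0 <= t <= s -> ddf t <= 0.
  move=> /andP[t0 ts]; rewrite /ddf dpE mulrA -expr2.
  rewrite -(real_normK (num_real sg)) sg2 expr1n mul1r.
  have At : 0 <= V - A * t by rewrite subr_ge0 VE ler_pM2l.
  have := vL (a + sg * t); rewrite addrAC subrr add0r normrM sg2 mul1r.
  rewrite (ger0_norm t0) => vt; rewrite subr_le0; apply: le_trans (hB _) _.
  by rewrite lerD2l lerN2 ler_wpM2l// ler_pXn2r ?nnegrE// (le_trans At).
have := le_tangent_of_derive2_le0 Df Ddf s0 ddf0.
rewrite /f /df !fctE mulr0 addr0 /p !poly.derivE !hornerE /= VE => H.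
have /andP[hs _] := hl (a + sg * s).
have /andP[_ ha] := hl a.
have sgs := mulr_le0_ge0 sgh s0.
have L : l <= 1 + (B / 2) * s ^+ 2 - l * A ^+ 2 * s ^+ 4 / 4 by lra.
have A2 : 0 <= A ^+ 2 by rewrite exprn_ge0// ltW.
have := ler_wpM2l A2 L; lra.
Qed.

(** Multiplying the hypothesis by l and using 2 l (1 - l) <= 1 - l^2 gives the
    homogeneous inequality Y^2 <= 2 B Y + 2 B^2 for Y = l X, which fails for
    Y > 25/9 B because (25/9)^2 > 2 (25/9) + 2. *)
Lemma linear_bound_of_quartic (R : realType) (l B A S X : R) :
  0 <= l <= 1 -> B = A * S -> S ^+ 2 = 1 - l ^+ 2 -> 0 <= B -> 0 <= X ->
  l * X ^+ 2 <= 2 * B * X + 4 * A ^+ 2 * (1 - l) ->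
  l * X <= (5 / 3) ^+ 2 * B.
Proof.
move=> /andP[l0 l1] BE SE B0 X0 H.
have Y : (l * X) ^+ 2 <= 2 * B * (l * X) + 2 * B ^+ 2.
  have A2 : 0 <= A ^+ 2 by exact: sqr_ge0.
  have := ler_wpM2l l0 H.
  have : l * (4 * A ^+ 2 * (1 - l)) <= 2 * B ^+ 2.
    rewrite BE exprMn SE.
    have : 0 <= A ^+ 2 * (1 - l) ^+ 2 by rewrite mulr_ge0// sqr_ge0.
    lra.
  lra.
rewrite leNgt; apply/negP => lt.
have : 0 <= l * X by rewrite mulr_ge0.
move: (l * X) lt Y => {H X0}Y lt H Y0; nra.
Qed.

(** * Kinematics of a curve on the sphere *)

Section curve.
Context (R : realType) (x : R -> 'rV[R]_3) (Cx : C2_sphere_curve x).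

Local Notation dx := (x^`()%classic).
Local Notation ddx := (dx^`()%classic).
Local Notation acc := (covderiv x dx).

Lemma curve_is_derive (t : R) : is_derive t 1 x (dx t).
Proof. by case: Cx => _ + _ _ => /(_ t) /derivableP; rewrite derive1E. Qed.

Lemma velocity_is_derive (t : R) : is_derive t 1 dx (ddx t).
Proof. by case: Cx => _ _ + _ => /(_ t) /derivableP; rewrite [ddx t]derive1E. Qed.

Lemma curve_unit t : dotp (x t) (x t) = 1.
Proof. by case: Cx => sx _ _ _; exact: dotp_sphere2. Qed.

Lemma velocity_orthogonal t : dotp (dx t) (x t) = 0.
Proof.
have D := is_derive_dotp (curve_is_derive t) (curve_is_derive t).
have E : (fun s => dotp (x s) (x s)) = cst 1.
  by apply/funext => s; exact: curve_unit.
have := @derive_val _ _ _ _ _ _ _ D; rewrite E derive_cst.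
rewrite [dotp (x t) _]dotpC; lra.
Qed.

Lemma acceleration_radial t : dotp (ddx t) (x t) = - dotp (dx t) (dx t).
Proof.
have D := is_derive_dotp (velocity_is_derive t) (curve_is_derive t).
have E : (fun s => dotp (dx s) (x s)) = cst 0.
  by apply/funext => s; exact: velocity_orthogonal.
have := @derive_val _ _ _ _ _ _ _ D; rewrite E derive_cst; lra.
Qed.

(** The covariant acceleration is tangent, so it only sees the tangential part of
    e, whose norm is the sine of the angle between e and x t; the radial part of
    the acceleration is the centripetal term. *)
Lemma height_derive2_le (e : 'rV[R]_3) t : sphere2 e ->
  dotp (ddx t) e <= enorm (acc t) * Num.sqrt (1 - dotp e (x t) ^+ 2)
                    - dotp e (x t) * enorm (dx t) ^+ 2.
Proof.
move=> /dotp_sphere2 e1.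
have -> : dotp (ddx t) e =
    dotp (acc t) e - dotp e (x t) * enorm (dx t) ^+ 2.
  rewrite /covderiv dotpDl -scaleNr dotpZl acceleration_radial sqr_enorm.
  rewrite (dotpC e); lra.
rewrite lerD2r.
have tan : dotp (acc t) (x t) = 0.
  by apply: covderiv_tangent; case: Cx.
rewrite dotpC -(dotp_tanprojl _ tan).
rewrite dotpC (le_trans (ler_norm _))// (le_trans (ler_norm_dotp _ _))//.
rewrite ler_wpM2l ?enorm_ge0//.
have -> // : enorm (tanproj (x t) e) = Num.sqrt (1 - dotp e (x t) ^+ 2).
congr Num.sqrt; rewrite dotp_tanprojl; last first.
  by apply: tanproj_tangent; case: Cx.
rewrite dotpC dotpDl e1 -scaleNr dotpZl (dotpC (x t)); lra.
Qed.

(** Only the covariant part of the acceleration changes the speed, the rest being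
    orthogonal to the velocity.  The speed need not be differentiable where it
    vanishes; hence the regularization sqrt (v^2 + d^2), which lies between v
    and v + d. *)
Lemma speed_lipschitz (A : R) : (forall t, enorm (acc t) <= A) ->
  forall a t, enorm (dx a) - A * `|t - a| <= enorm (dx t).
Proof.
move=> HA a t; apply/ler_addgt0Pr => d d0.
pose g s := dotp (dx s) (dx s) + d ^+ 2.
have d2 : 0 < d ^+ 2 by rewrite exprn_gt0.
have g0 s : 0 < g s by rewrite ltr_wpDl ?dotp_ge0.
pose w s := Num.sqrt (g s).
have w0 s : 0 < w s by rewrite sqrtr_gt0.
have Dw (s : R) : is_derive s 1 w (dotp (acc s) (dx s) / w s).
  have Dg : is_derive s 1 g (2 * dotp (ddx s) (dx s)).
    have D := is_derive_dotp (velocity_is_derive s) (velocity_is_derive s).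
    have -> : g = (fun s => dotp (dx s) (dx s)) + cst (d ^+ 2) by [].
    apply: is_derive_eq; rewrite addr0 [X in _ + X]dotpC; lra.
  have := is_derive1_comp (is_derive1_sqrt (g0 s)) Dg.
  rewrite /w (dotp_tanprojl _ (velocity_orthogonal s)).
  suff -> : (2 * Num.sqrt (g s))^-1 * (2 * dotp (ddx s) (dx s)) =
    dotp (ddx s) (dx s) / Num.sqrt (g s) by [].
  by field; rewrite gt_eqF//; exact: w0.
have vw s : enorm (dx s) <= w s.
  by rewrite ler_wsqrtr// lerDl ltW.
have wA s : `|dotp (acc s) (dx s) / w s| <= A.
  rewrite normrM normfV (gtr0_norm (w0 s)) ler_pdivrMr//.
  apply: le_trans (ler_norm_dotp _ _) _.
  by rewrite ler_pM ?enorm_ge0.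
have := derive_bound_le a t Dw wA.
have wt : w t <= enorm (dx t) + d.
  rewrite -(@ler_pXn2r _ 2) ?nnegrE ?addr_ge0 ?enorm_ge0 ?(ltW d0) ?(ltW (w0 t))//.
  rewrite sqr_sqrtr ?(ltW (g0 t))// /g -sqr_enorm sqrrD.
  by rewrite lerD2r lerDl mulrn_wge0// mulr_ge0 ?enorm_ge0// ltW.
have := vw a; rewrite (distrC (w t)) => va.
have := ler_norm (w a - w t); lra.
Qed.

Lemma height_le1 (e : 'rV[R]_3) t : sphere2 e -> `|dotp e (x t)| <= 1.
Proof.
move=> e1; apply: le_trans (ler_norm_dotp _ _) _.
by case: Cx => sx _ _ _; rewrite (e1 : enorm e = 1) (sx t : enorm _ = 1) mul1r.
Qed.

Lemma speed_bound (e : 'rV[R]_3) (l A : R) :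
  sphere2 e -> 0 < l -> (forall t, l <= dotp e (x t)) ->
  (forall t, enorm (acc t) <= A) ->
  forall t, l * enorm (dx t) ^+ 2 <= (5 / 3) ^+ 2 * (A * Num.sqrt (1 - l ^+ 2)).
Proof.
move=> e1 l0 le HA a.
have h1 t : dotp e (x t) <= 1 := le_trans (ler_norm _) (height_le1 t e1).
have l1 : l <= 1 := le_trans (le 0) (h1 0).
have ll : l ^+ 2 <= 1 by rewrite expr_le1// ltW.
set S := Num.sqrt _.
have S0 : 0 <= S := sqrtr_ge0 _.
have SE : S ^+ 2 = 1 - l ^+ 2 by rewrite sqr_sqrtr// subr_ge0.
have S1 : S <= 1 by rewrite -(@expr_le1 _ 2)// SE gerBl sqr_ge0.
have A0 : 0 <= A := le_trans (enorm_ge0 _) (HA 0).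
(* A may vanish, whereas the comparison divides by it: enlarge A by an amount
   which changes the right-hand side by at most d. *)
apply/ler_addgt0Pr => d d0.
pose A' := A + d / (5 / 3) ^+ 2.
have dd0 : 0 < d / (5 / 3) ^+ 2 by rewrite divr_gt0// exprn_gt0.
have A'0 : 0 < A' by rewrite ltr_wpDl.
have HA' t : enorm (acc t) <= A' by rewrite (le_trans (HA t))// lerDl ltW.
have Dh (t : R) : is_derive t 1 (fun s => dotp (x s) e) (dotp (dx t) e).
  apply: is_derive_eq (is_derive_dotp (curve_is_derive t) (is_derive_cst e t 1)) _.
  by rewrite [X in _ + X]dotpC -[0](scale0r e) dotpZl mul0r addr0.
have Ddh (t : R) : is_derive t 1 (fun s => dotp (dx s) e) (dotp (ddx t) e).
  apply: is_derive_eq (is_derive_dotp (velocity_is_derive t) (is_derive_cst e t 1)) _.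
  by rewrite [X in _ + X]dotpC -[0](scale0r e) dotpZl mul0r addr0.
have ddh t : dotp (ddx t) e <= A' * S - l * enorm (dx t) ^+ 2.
  apply: le_trans (height_derive2_le t e1) _.
  apply: lerB; last by rewrite ler_wpM2r// sqr_ge0.
  apply: ler_pM; rewrite ?enorm_ge0 ?sqrtr_ge0//.
  rewrite ler_wsqrtr// lerD2l lerN2 ler_pXn2r// nnegrE ?(ltW l0)//.
  exact: le_trans (ltW l0) (le t).
have hl t : l <= dotp (x t) e <= 1 by rewrite dotpC le h1.
have B0 : 0 <= A' * S by rewrite mulr_ge0// ltW.
have := quartic_bound (v := fun t => enorm (dx t)) Dh Ddh A'0 (ltW l0) hl
  (enorm_ge0 (dx a)) (speed_lipschitz HA' a) ddh.
move=> Q.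
have l01 : 0 <= l <= 1 by rewrite ltW.
apply: le_trans (linear_bound_of_quartic l01 erefl SE B0 (sqr_ge0 _) Q) _.
have -> : (5 / 3) ^+ 2 * (A' * S) = (5 / 3) ^+ 2 * (A * S) + d * S.
  by rewrite /A'; field.
by rewrite lerD2l ler_piMr// ltW.
Qed.

End curve.

(** * Suprema and the constant *)

(** If r bounds all sqrt (1 - h^2), then sqrt (1 - r^2) is a lower bound of h,
    hence at most inf h; this avoids any discussion of whether the infimum is
    attained. *)
Lemma supnorm_sine (R : realType) (h : R -> R) :
  (forall t, `|h t| <= 1) -> 0 < inf (range h) ->
  supnorm (fun t => Num.sqrt (1 - h t ^+ 2)) =
  (Num.sqrt (1 - inf (range h) ^+ 2))%:E.
Proof.
move=> h1; set l := inf _ => l0.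
have hlb : has_lbound (range h).
  by exists (-1) => _ [t _ <-]; move: (h1 t); rewrite ler_norml => /andP[].
have lh t : l <= h t by apply: ge_inf => //; exists t.
have sub1 t : 0 <= 1 - h t ^+ 2.
  by rewrite subr_ge0 -real_normK ?num_real// expr_le1.
apply/eqP; rewrite eq_le; apply/andP; split.
  apply/ereal_supP => _ [t _ <-]; rewrite lee_fin ger0_norm ?sqrtr_ge0//.
  rewrite ler_wsqrtr// lerD2l lerN2 ler_pXn2r// nnegrE ?(ltW l0)//.
  exact: le_trans (ltW l0) (lh t).
set M := supnorm _.
have Mub t : ((Num.sqrt (1 - h t ^+ 2))%:E <= M)%E.
  apply: ereal_sup_ubound; exists t => //.
  by rewrite ger0_norm ?sqrtr_ge0.
case: M Mub => [r| |] Mub; rewrite ?leey//; last by have := Mub 0.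
have r0 : 0 <= r by have := Mub 0; rewrite lee_fin; apply: le_trans (sqrtr_ge0 _).
suff rl : 1 - r ^+ 2 <= l ^+ 2.
  rewrite lee_fin -[leRHS](ger0_norm r0) -sqrtr_sqr ler_wsqrtr//; lra.
have srl : Num.sqrt (1 - r ^+ 2) <= l.
  apply: lb_le_inf; first by exists (h 0), 0.
  move=> _ [t _ <-].
  have ht : 0 <= h t := le_trans (ltW l0) (lh t).
  rewrite -[leRHS](ger0_norm ht) -sqrtr_sqr ler_wsqrtr//.
  have := Mub t; rewrite lee_fin -(@ler_pXn2r _ 2) ?nnegrE ?sqrtr_ge0//.
  rewrite sqr_sqrtr//; lra.
have [r1|/ltW r1] := leP 0 (1 - r ^+ 2); last by rewrite (le_trans r1)// sqr_ge0.
by rewrite -(sqr_sqrtr r1) ler_pXn2r// nnegrE ?sqrtr_ge0 ?(ltW l0).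
Qed.

Lemma cubic_root_ge (R : realType) :
  exists zeta : R, [/\ 0 < zeta, zeta ^+ 3 - 3 * zeta - 1 = 0 & 5 / 3 <= zeta].
Proof.
pose p : {poly R} := 'X^3 - 3 *: 'X - 1%:P.
have pE z : p.[z] = z ^+ 3 - 3 * z - 1 by rewrite !hornerE; ring.
have p02 : p.[5 / 3] <= 0 <= p.[2] by rewrite !pE; apply/andP; split; lra.
have [|z /andP[z0 _] /rootP] := @poly_ivt _ p (5 / 3) 2 _ p02; first lra.
by rewrite pE => pz; exists z; split=> //; lra.
Qed.

Theorem theorem2 (R : realType) :
  exists C : R,
    [/\ 0 < C,
        exists zeta : R, [/\ 0 < zeta, zeta ^+ 3 - 3 * zeta - 1 = 0 & C <= zeta] &
        forall (x : R -> 'rV[R]_3) (e : 'rV[R]_3),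
          C2_sphere_curve x ->
          sphere_argmin (supdist x) e ->
          let lambda := inf (range (fun t => dotp (x t) e)) in
          0 < lambda ->
          (vsupnorm (covderiv x x^`()%classic) < +oo)%E ->
          (vsupnorm x^`()%classic ^+ 2
             <= (C ^+ 2 / lambda)%:E
                * supnorm (fun t => Num.sqrt (1 - dotp e (x t) ^+ 2))
                * vsupnorm (covderiv x x^`()%classic))%E
          /\
          ((C ^+ 2 / lambda)%:E
             * supnorm (fun t => Num.sqrt (1 - dotp e (x t) ^+ 2))
             * vsupnorm (covderiv x x^`()%classic)
             <= (C ^+ 2 * Num.sqrt (1 - lambda ^+ 2) / lambda)%:E
                * vsupnorm (covderiv x x^`()%classic))%E].
Proof.
exists (5 / 3); split; [lra|exact: cubic_root_ge|].
move=> x e Cx [e1 _]; rewrite /=.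
have -> : (fun t => dotp (x t) e) = (fun t => dotp e (x t)).
  by apply/funext => t; rewrite dotpC.
have h1 t := height_le1 Cx t e1.
set l := inf _ => l0 Afin.
have lh t : l <= dotp e (x t).
  apply: ge_inf; last by exists t.
  by exists (-1) => _ [s _ <-]; move: (h1 s); rewrite ler_norml => /andP[].
rewrite (supnorm_sine h1 l0) -/l.
have Aub t : ((enorm (covderiv x x^`()%classic t))%:E
              <= vsupnorm (covderiv x x^`()%classic))%E.
  by apply: ereal_sup_ubound; exists t.
case: (vsupnorm (covderiv _ _)) Afin Aub => [A| |] // _ Aub; last first.
  by have := Aub 0.
have {}Aub t : enorm (covderiv x x^`()%classic t) <= A by rewrite -lee_fin.
have A0 : 0 <= A := le_trans (enorm_ge0 _) (Aub 0).
rewrite -!EFinM; split; last by rewrite lee_fin [_ / l * _]mulrAC.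
set M := (X in (_ <= X%:E)%E).
have M0 : 0 <= M by rewrite !mulr_ge0 ?invr_ge0 ?(ltW l0) ?sqrtr_ge0//; lra.
rewrite -(sqr_sqrtr M0) EFin_expe lee_sqr ?lee_fin ?sqrtr_ge0//; last first.
  apply: le_trans (ereal_sup_ubound _); last by exists 0.
  by rewrite lee_fin enorm_ge0.
apply/ereal_supP => _ [t _ <-]; rewrite lee_fin.
rewrite -(ger0_norm (enorm_ge0 _)) -sqrtr_sqr ler_wsqrtr//.
have := speed_bound Cx e1 l0 lh Aub t.
rewrite -ler_pdivlMl// => /le_trans; apply.
by rewrite /M le_eqVlt; apply/orP; left; apply/eqP; field; rewrite gt_eqF.
Qed.
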